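(* Let $\gamma, \rho, c > 0$ and put $\overline{\gamma} = \min(\gamma, 1)$. Let $A \subseteq [0,1]^2$ be a $(\rho,\gamma)_c$-set with $n := |A| > -\log c$. Then for all $\delta > 0$ and all $0 \le m \le \delta^2 n/4$, the set \[ E = \big\{ \theta \in [0,\pi) \ \big|\ \exists A' \subseteq A \text{ with } |A'| \ge \delta n \text{ and } \mathcal{N}(\pi_\theta A', \rho) \le m \big\} \] satisfies \[ \mathcal{N}(E,\rho) \le K \rho^{-1} \frac{m}{\delta^2 n} \cdot \begin{cases} n^{1-\overline{\gamma}/\gamma} & \text{if } \gamma \ne 1, \\ \log n & \text{if } \gamma = 1, \end{cases} \] where $K>0$ is a constant depending only on $\gamma$ and $c$.
   Context: A set $X\subseteq\mathbb{R}^d$ is $\rho$-separated if any two distinct points of $X$ are at Euclidean distance at least $\rho$. The metric entropy $\mathcal{N}(X,\rho)$ is the supremum of $|X_0|$ over all $\rho$-separated subsets $X_0 \subseteq X$. A set $X \subseteq \mathbb{R}^d$ is a $(\rho,\gamma)_c$-set if it is $\rho$-separated and for all $\delta' \ge \rho$ and all open balls $B$ of diameter $\delta'$, $|X \cap B| \le c(\delta'/\rho)^\gamma$. For $\theta\in[0,\pi)$, $\pi_\theta\colon\mathbb{R}^2\to\mathbb{R}^2$ is the orthogonal projection onto the line through the origin forming angle $\theta$ with the positive $x$-axis. *)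

(* Defs.v *)
From HB Require Import structures.
From mathcomp Require Import all_boot all_order all_algebra.
From mathcomp Require Import all_classical all_reals all_analysis.
Set Implicit Arguments.
Unset Strict Implicit.
Unset Printing Implicit Defensive.
Import Order.TTheory GRing.Theory Num.Theory.
Local Open Scope classical_set_scope.
Local Open Scope ring_scope.

(* The norm that MathComp-Analysis puts on 'rV[R]_d is the sup norm, hence the
   explicit Euclidean distance. *)
Definition edist (R : realType) (d : nat) (x y : 'rV[R]_d) : R :=
  Num.sqrt (\sum_(i < d) (x 0 i - y 0 i) ^+ 2).

Definition rho_separated (R : realType) (d : nat) (rho : R)
  (X : set 'rV[R]_d) : Prop :=
  forall x y, X x -> X y -> x <> y -> rho <= edist x y.

(* [counting X0] is the number of elements of X0, and +oo if X0 is infinite. *)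
Definition metric_entropy (R : realType) (d : nat) (X : set 'rV[R]_d)
  (rho : R) : \bar R :=
  ereal_sup [set counting X0 | X0 in
    [set X0 : set 'rV[R]_d | X0 `<=` X /\ rho_separated rho X0]].

Definition eball (R : realType) (d : nat) (z : 'rV[R]_d) (r : R) :
  set 'rV[R]_d := [set y | edist z y < r].

(* Open balls of diameter delta' are the Euclidean balls of radius
   delta' / 2. *)
Definition rho_gamma_set (R : realType) (d : nat) (rho gamma c : R)
  (X : set 'rV[R]_d) : Prop :=
  rho_separated rho X /\
  forall (delta' : R) (z : 'rV[R]_d), rho <= delta' ->
    (counting (X `&` eball z (delta' / 2)%R)
      <= (c * (delta' / rho) `^ gamma)%:E)%E.

Definition direction (R : realType) (theta : R) : 'rV[R]_2 :=
  \row_(i < 2) (if i == 0 then cos theta else sin theta).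

(* Orthogonal projection onto the line spanned by the unit vector
   [direction theta]: the scalar coefficient is the dot product with x. *)
Definition line_proj (R : realType) (theta : R) (x : 'rV[R]_2) : 'rV[R]_2 :=
  (\sum_(i < 2) x 0 i * direction theta 0 i) *: direction theta.

(* The identification of R with R^1. *)
Definition to_R1 (R : realType) (t : R) : 'rV[R]_1 := const_mx t.

(* Main.v *)
(* Double counting of the pairs x <> y in A and the directions theta of a
   rho-separated subset of E for which |pi_theta (x - y)| < 2 rho.  For a fixed
   theta, Cauchy-Schwarz gives at least (delta n)^2 / m - n such pairs, of which
   the term n is at most a quarter since m <= delta^2 n / 4.  For a fixed pair
   there are only O(1 / |x - y|) such directions.  Listing the points y by
   increasing distance to x, the k-th distance is at least a constant times
   rho k^(1/gamma), so the sum of 1 / |x - y| over y is O(rho^-1) times the sum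
   of k^(-1/gamma) over k <= n, which produces the three regimes of gamma. *)

Require Import Defs.
From HB Require Import structures.
From mathcomp Require Import all_boot all_order all_algebra.
From mathcomp Require Import all_classical all_reals all_analysis.
From mathcomp Require Import ring lra zify.
Set Implicit Arguments.
Unset Strict Implicit.
Unset Printing Implicit Defensive.
Import Order.TTheory GRing.Theory Num.Theory.
Import numFieldNormedType.Exports.
Local Open Scope classical_set_scope.
Local Open Scope ring_scope.

(** * Power sums and sums of reciprocals *)

(** This is [1 + x <= exp x] at [x = q * ln (y / z)]: as a function of [ln y], the power lies above
    its tangent at [ln z]. It holds for either sign of [q] and replaces comparison with integrals in
    the sums below. *)
Lemma powR_ge_ln (R : realType) (q y z : R) :
  0 < y -> 0 < z -> z `^ q * (1 + q * (ln y - ln z)) <= y `^ q.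
Proof.
move=> y0 z0; have -> : y = z * (y / z) by field; rewrite gt_eqF.
have yz0 : 0 < y / z by rewrite divr_gt0.
rewrite powRM ?(ltW z0) ?(ltW yz0)// lnM ?posrE// [ln z + _]addrC addrK.
rewrite ler_wpM2l ?powR_ge0// /powR (gt_eqF yz0).
exact: expR_ge1Dx.
Qed.

Lemma ln_sub_ge (R : realType) (y z : R) :
  0 < y -> 0 < z -> 1 - z / y <= ln y - ln z.
Proof.
move=> y0 z0; have zy0 : 0 < z / y by rewrite divr_gt0.
have := @expR_ge1Dx R (ln (z / y)); rewrite lnK ?posrE//.
rewrite ln_div ?posrE//; lra.
Qed.

Lemma powR_subr1 (R : realType) (x q : R) :
  0 < x -> x `^ q / x = x `^ (q - 1).
Proof.
move=> x0; rewrite powRD; last by rewrite (gt_eqF x0) implybT.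
by rewrite powR_inv1 // ltW.
Qed.

Lemma sum_powR_le (R : realType) (a : R) (n : nat) : 1 < a ->
  \sum_(k < n) k.+1%:R `^ (- a) <= 1 + (a - 1)^-1.
Proof.
move=> a1; have b0 : 0 < a - 1 by lra.
have Vb0 : 0 < (a - 1)^-1 by rewrite invr_gt0.
case: n => [|n]; first by rewrite big_ord0; lra.
(* The subtracted term is the integral of [x^(-a)] from [n + 1] to infinity; keeping this tail makes
   the induction close. *)
suff : \sum_(k < n.+1) k.+1%:R `^ (- a)
    <= 1 + (a - 1)^-1 - (a - 1)^-1 * n.+1%:R `^ (- (a - 1)).
  by move/le_trans; apply; rewrite gerBl mulr_ge0 ?powR_ge0 ?(ltW Vb0).
elim: n => [|n IH]; first by rewrite big_ord1 !powR1; lra.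
rewrite big_ord_recr /=.
suff H : n.+2%:R `^ (- a) <= (a - 1)^-1 *
    (n.+1%:R `^ (- (a - 1)) - n.+2%:R `^ (- (a - 1))) by lra.
have y0 : 0 < n.+1%:R :> R by rewrite ltr0n.
have x0 : 0 < n.+2%:R :> R by rewrite ltr0n.
rewrite mulrC -[leRHS]/(_ / _) ler_pdivlMr//.
have -> : - a = - (a - 1) - 1 by ring.
rewrite -powR_subr1//.
have h1 := powR_ge_ln (- (a - 1)) y0 x0.
have h2 := ln_sub_ge x0 y0.
have h3 : 1 - n.+1%:R / n.+2%:R = n.+2%:R^-1 :> R.
  rewrite -[n.+2]addn1 natrD; field.
  by rewrite gt_eqF // -natr1 in x0 *.
rewrite h3 in h2.
set P := n.+2%:R `^ _ in h1 *; set Q := n.+1%:R `^ _ in h1 *.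
have P0 : 0 <= P by rewrite powR_ge0.
have : P * ((a - 1) * n.+2%:R^-1)
    <= P * ((a - 1) * (ln n.+2%:R - ln n.+1%:R)).
  by rewrite ler_wpM2l// ler_wpM2l// ltW.
move: h1; move: n.+2%:R^-1 (ln n.+2%:R) (ln n.+1%:R) => V l2 l1; lra.
Qed.

Lemma sum_powR_le_powR (R : realType) (a : R) (n : nat) : 0 < a < 1 ->
  \sum_(k < n) k.+1%:R `^ (- a) <= 4 / (1 - a) * n%:R `^ (1 - a).
Proof.
move=> /andP[a0 a1]; have p0 : 0 < 1 - a by lra.
have Vp0 : 0 < (1 - a)^-1 by rewrite invr_gt0.
case: n => [|n]; first by rewrite big_ord0 mulr_ge0 ?powR_ge0 //; lra.
(* With the shift to [m.+1], powers and logarithms are only compared at positive numbers. Undoing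
   the shift doubles the constant, since [n + 2 <= 2 (n + 1)]. *)
suff H m : \sum_(k < m) k.+1%:R `^ (- a)
    <= 2 / (1 - a) * m.+1%:R `^ (1 - a).
  apply: (le_trans (H _)).
  have h : n.+2%:R `^ (1 - a) <= 2 * n.+1%:R `^ (1 - a) :> R.
    apply: (@le_trans _ _ ((2 * n.+1%:R) `^ (1 - a))).
      apply: ge0_ler_powR; rewrite ?(ltW p0) ?nnegrE -?natrM ?ler0n ?ler_nat//.
      by rewrite mul2n -addnn addSnnS leq_addl.
    rewrite powRM// ler_wpM2r ?powR_ge0//.
    rewrite -[leRHS](@powRr1 R 2)// ler_powR//; lra.
  have -> : 4 / (1 - a) = 2 / (1 - a) * 2 by lra.
  by rewrite -[leRHS]mulrA ler_wpM2l// mulr_ge0 // ltW.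
elim: m => [|m IH]; first by rewrite big_ord0 powR1; lra.
rewrite big_ord_recr /=.
suff H : m.+1%:R `^ (- a) <= 2 / (1 - a) *
    (m.+2%:R `^ (1 - a) - m.+1%:R `^ (1 - a)) by lra.
have y0 : 0 < m.+1%:R :> R by rewrite ltr0n.
have x0 : 0 < m.+2%:R :> R by rewrite ltr0n.
rewrite mulrC mulrA ler_pdivlMr//.
have -> : m.+1%:R `^ (- a) = m.+1%:R `^ (1 - a) / m.+1%:R.
  by rewrite powR_subr1//; congr (_ `^ _); ring.
have h1 := powR_ge_ln (1 - a) x0 y0.
have h2 := ln_sub_ge x0 y0.
(* The logarithms differ by at least [1 / (m + 2)], hence by at least half of [1 / (m + 1)]: this is
   the 2 in the constant. *)
have h3 : m.+1%:R^-1 / 2 <= 1 - m.+1%:R / m.+2%:R :> R.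
  have -> : 1 - m.+1%:R / m.+2%:R = m.+2%:R^-1 :> R.
    rewrite -[m.+2]addn1 natrD; field.
    by rewrite gt_eqF // -natr1 in x0 *.
  rewrite -invfM lef_pV2 ?posrE ?mulr_gt0// -natrM ler_nat.
  by rewrite muln2 -addnn addSnnS leq_addl.
set P := m.+1%:R `^ _ in h1 *; set Q := m.+2%:R `^ _ in h1 *.
have P0 : 0 <= P by rewrite powR_ge0.
have : P * ((1 - a) * (m.+1%:R^-1 / 2))
    <= P * ((1 - a) * (ln m.+2%:R - ln m.+1%:R)).
  by rewrite ler_wpM2l// ler_wpM2l ?(ltW p0)// (le_trans h3).
move: h1; move: m.+1%:R^-1 (ln m.+2%:R) (ln m.+1%:R) => V l2 l1; lra.
Qed.

(** Induction gives [1 + ln n], and the 1 is at most [2 * ln n] because [ln 2 >= 1 / 2]. *)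
Lemma harmonic_sum_le_ln (R : realType) (n : nat) : (1 < n)%N ->
  \sum_(k < n) k.+1%:R `^ (- 1) <= 3 * ln n%:R :> R.
Proof.
case: n => // n n0.
have H m : \sum_(k < m.+1) k.+1%:R `^ (- 1) <= 1 + ln m.+1%:R :> R.
  elim: m => [|m IH]; first by rewrite big_ord1 powR1 ln1 addr0.
  rewrite big_ord_recr /= powR_inv1//.
  have y0 : 0 < m.+1%:R :> R by rewrite ltr0n.
  have x0 : 0 < m.+2%:R :> R by rewrite ltr0n.
  have := ln_sub_ge x0 y0.
  have -> : 1 - m.+1%:R / m.+2%:R = m.+2%:R^-1 :> R.
    rewrite -[m.+2]addn1 natrD; field.
    by rewrite gt_eqF // -natr1 in x0 *.
  by move: IH; move: (ln m.+1%:R) (ln m.+2%:R) m.+2%:R^-1 => l1 l2 V; lra.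
apply: (le_trans (H n)).
have := @ln_sub_ge R 2 1 (ltr0Sn R 1) ltr01.
have : ln 2 <= ln n.+1%:R :> R by rewrite ler_ln ?posrE ?ltr0n// ler_nat.
rewrite ln1; lra.
Qed.

(** For [gamma < 1] the series converges, in accordance with the exponent being 0. The condition
    [1 < n] comes from [gamma = 1], where [ln 1 = 0] cannot bound a sum that contains the term 1. *)
Lemma sum_powR_growth (R : realType) (gamma : R) : 0 < gamma ->
  exists2 D : R, 0 < D & forall n : nat, (1 < n)%N ->
    \sum_(k < n) k.+1%:R `^ (- gamma^-1) <=
    D * (if gamma != 1 then n%:R `^ (1 - Num.min gamma 1 / gamma)
         else ln n%:R).
Proof.
move=> g0; have [g1|g1|->] := ltgtP gamma 1.
- have a1 : 1 < gamma^-1 by rewrite invf_gt1.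
  have := a1; rewrite -subr_gt0 -invr_gt0 => b0.
  exists (1 + (gamma^-1 - 1)^-1); first by lra.
  by move=> n _; rewrite divff ?gt_eqF// subrr powRr0 mulr1 sum_powR_le.
- have a1 : gamma^-1 < 1 by rewrite invf_lt1.
  exists (4 / (1 - gamma^-1)); first by rewrite divr_gt0// subr_gt0.
  move=> n _; rewrite div1r sum_powR_le_powR// invr_gt0 g0//.
- by exists 3 => // n n1; rewrite invr1 harmonic_sum_le_ln.
Qed.

(* After sorting, the k-th smallest value v satisfies k <= C v^gamma, that is
   1/v <= C^(1/gamma) k^(-1/gamma). *)
Lemma sum_inv_le (R : realType) (C gamma : R) (s : seq R) :
  0 <= C -> 0 < gamma -> {in s, forall v, 0 < v} ->
  (forall t, 0 < t -> (count (fun v => v <= t) s)%:R <= C * t `^ gamma) ->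
  \sum_(v <- s) v^-1 <=
    C `^ gamma^-1 * \sum_(k < size s) k.+1%:R `^ (- gamma^-1).
Proof.
move=> C0 g0.
have Hperm : perm_eq (sort >=%R s) s by rewrite perm_sort.
rewrite -(perm_big _ Hperm) -(perm_size Hperm) => s0 scount.
have {s0} : {in sort >=%R s, forall v, 0 < v}.
  by move=> v; rewrite mem_sort; apply: s0.
have {scount} : forall t, 0 < t ->
    (count (fun v => v <= t) (sort >=%R s))%:R <= C * t `^ gamma.
  by move=> t; rewrite (seq.permP Hperm); apply: scount.
have : sorted >=%R (sort >=%R s) by apply: sort_sorted => x y; apply: le_total.
(* The order is decreasing: the head [v] is the largest value, so the count at level [v] is the full
   length, and [v] is paired with the last index. *)
elim: (sort _ s) => [|v l IH] vs_sorted vs_count vs0.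
  by rewrite big_nil big_ord0 mulr0.
have v0 : 0 < v by apply: vs0; rewrite mem_head.
rewrite big_cons big_ord_recr /= mulrDr addrC lerD //.
  apply: IH; first exact: path_sorted vs_sorted.
    move=> t t0; apply: le_trans (vs_count t t0).
    by rewrite ler_nat /= leq_addl.
  by move=> x xl; apply: vs0; rewrite inE xl orbT.
have /(order_path_min ge_trans)/allP lv := vs_sorted.
have : (size l).+1%:R <= C * v `^ gamma.
  apply: le_trans (vs_count v v0); rewrite ler_nat /= lexx add1n ltnS.
  by rewrite (eq_in_count (a2 := xpredT)) ?count_predT// => x /lv.
have N0 : 0 < (size l).+1%:R :> R by rewrite ltr0n.
move: (size l).+1%:R N0 => N N0 hN.
rewrite powRN ler_pdivlMr ?powR_gt0// mulrC ler_pdivrMr//.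
have -> : C `^ gamma^-1 * v = (C * v `^ gamma) `^ gamma^-1.
  by rewrite powRM ?powR_ge0// -powRrM mulfV ?gt_eqF// powRr1// ltW.
by apply: ge0_ler_powR; rewrite ?nnegrE ?invr_ge0 ?(ltW g0) ?(ltW N0)
  ?mulr_ge0 ?powR_ge0.
Qed.

(** * Directions nearly orthogonal to a fixed vector *)

(** The mean value theorem at [x / 2] gives [sin (x / 2) >= cos (x / 2) * x / 2]. Doubling the angle
    yields [sin x >= cos (x / 2) ^ 2 * x], and [2 * cos (x / 2) ^ 2 = 1 + cos x >= 1]. *)
Lemma sin_ge_half (R : realType) (x : R) : 0 <= x <= pi / 2 -> x / 2 <= sin x.
Proof.
move=> /andP[x0 x1].
have [y yx] : exists2 y, y \in `[0, x / 2] &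
    sin (x / 2) - sin 0 = cos y * (x / 2 - 0).
  apply: MVT_segment; first lra.
  exact/continuous_subspaceT/continuous_sin.
rewrite sin0 !subr0 => sin_half.
move: yx; rewrite in_itv /= => /andP[y0 yx].
have pi0 := @pi_gt0 R.
have c0 : 0 <= cos (x / 2) by apply: cos_ge0_pihalf; lra.
have cy : cos (x / 2) <= cos y.
  by rewrite leNgt ltr_cos ?in_itv /= -?leNgt; lra.
have cx : 0 <= cos x by apply: cos_ge0_pihalf; lra.
have -> : sin x = (cos (x / 2) * sin (x / 2)) *+ 2.
  by rewrite -sin_mulr2n; congr sin; lra.
have := cos_mulr2n (x / 2); rewrite (_ : x / 2 *+ 2 = x); last lra.
move: cx; move: (cos x) (cos (x / 2)) (cos y) sin_half c0 cy =>
  k h l -> h0 hl k0 kE.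
have : h * h * x <= h * l * x by rewrite ler_wpM2r // ler_wpM2l.
have : x <= 2 * (h * h) * x
  by rewrite ler_peMl //; move: kE; rewrite expr2; lra.
lra.
Qed.

(** Cut the interval into cells of length [rho] from [a] on: each cell holds at most one point, and
    the cell indices run from 0 to the integer part of [L / rho]. *)
Lemma interval_packing (R : realType) (rho a L : R) (s : seq R) :
  0 < rho -> 0 <= L -> uniq s -> {in s, forall x, a <= x <= a + L} ->
  {in s &, forall x y, x != y -> rho <= `|x - y|} ->
  (size s)%:R <= L / rho + 1.
Proof.
move=> rho0 L0 us sI ssep.
pose f x := Num.truncn ((x - a) / rho).
have f0 x : x \in s -> 0 <= (x - a) / rho.
  by move=> /sI ?; rewrite divr_ge0 ?(ltW rho0)//; lra.
have finj : {in s &, injective f}.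
  move=> x y xs ys fxy; apply/eqP/negPn/negP => /(ssep _ _ xs ys).
  have /andP[x1 x2] := truncn_itv (f0 x xs).
  have /andP[y1 y2] := truncn_itv (f0 y ys).
  rewrite -/(f x) -/(f y) -fxy -natr1 in x1 x2 y1 y2.
  apply/negP; rewrite -ltNge.
  have : `|(x - a) / rho - (y - a) / rho| < 1 by rewrite ltr_norml; lra.
  rewrite -mulrBl normrM (gtr0_norm (x := rho^-1)) ?invr_gt0//.
  rewrite ltr_pdivrMr// mul1r.
  by have -> : x - a - (y - a) = x - y by ring.
have LE : 0 <= L / rho by rewrite divr_ge0 ?(ltW rho0).
have : (size (map f s) <= size (iota 0 (Num.truncn (L / rho)).+1))%N.
  apply: uniq_leq_size; first by rewrite map_inj_in_uniq.
  move=> _ /mapP[x xs ->]; rewrite mem_iota add0n ltnS /=.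
  apply: le_truncn; rewrite ler_pM2r ?invr_gt0//.
  by have := sI x xs; lra.
rewrite size_map size_iota -(ler_nat R) => /le_trans; apply.
by rewrite -natr1 lerD2r; have /andP[] := truncn_itv LE.
Qed.

Lemma proj_sin_bound (R : realType) (u w p q t : R) :
  `|u * cos p + w * sin p| < t -> `|u * cos q + w * sin q| < t ->
  (u ^+ 2 + w ^+ 2) * sin (p - q) ^+ 2 < (2 * t) ^+ 2.
Proof.
set P := u * cos p + _; set Q := u * cos q + _ => hP hQ.
have -> : (u ^+ 2 + w ^+ 2) * sin (p - q) ^+ 2 =
    P ^+ 2 + Q ^+ 2 - 2 * (P * Q) * cos (p - q).
  (* Cramer's rule: the two dot products [P] and [Q] determine [u * sin (p - q)] and
     [w * sin (p - q)]. *)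
  have -> : (u ^+ 2 + w ^+ 2) * sin (p - q) ^+ 2 =
      (Q * sin p - P * sin q) ^+ 2 + (P * cos q - Q * cos p) ^+ 2.
    by rewrite sinB /P /Q; ring.
  have := cos2Dsin2 p; have := cos2Dsin2 q; rewrite cosB.
  move: (cos p) (sin p) (cos q) (sin q) => a b c d h1 h2.
  have -> : (Q * b - P * d) ^+ 2 + (P * c - Q * a) ^+ 2 =
    P ^+ 2 * (c ^+ 2 + d ^+ 2) + Q ^+ 2 * (a ^+ 2 + b ^+ 2)
    - 2 * (P * Q) * (a * c + b * d) by ring.
  by rewrite h1 h2 !mulr1.
have hPQ : `|P * Q * cos (p - q)| <= `|P| * `|Q|.
  by rewrite !normrM ler_piMr ?mulr_ge0// cos_max.
have hE : (`|P| + `|Q|) ^+ 2 = P ^+ 2 + Q ^+ 2 + 2 * (`|P| * `|Q|).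
  by rewrite -(real_normK (num_real P)) -(real_normK (num_real Q)); ring.
apply: (@le_lt_trans _ _ ((`|P| + `|Q|) ^+ 2)).
  by rewrite hE; move: hPQ; rewrite ler_norml => /andP[]; lra.
have P0 := normr_ge0 P; have Q0 := normr_ge0 Q.
by rewrite ltr_pXn2r // ?nnegrE; lra.
Qed.

Lemma size_le_count3 (T : Type) (a b c : pred T) (s : seq T) :
  all (fun x => [|| a x, b x | c x]) s ->
  (size s <= count a s + count b s + count c s)%N.
Proof.
elim: s => //= x s IH /andP[abc /IH {}IH].
by case: (a x) (b x) (c x) abc IH => -[] -[] //=; lia.
Qed.

(* By [proj_sin_bound] two directions that are nearly orthogonal to (u, w)
   satisfy |sin (x - t)| < h with h = 4 rho / r, so all of them lie in intervals
   of lengths 4h, 2h, 2h around t, t + pi, t - pi.  Packing gives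
   8h / rho + 3 = 32 / r + 3, and 3 <= 6 / r because r <= 2. *)
Lemma count_directions (R : realType) (rho u w r : R) (s : seq R) :
  0 < rho -> 0 < r <= 2 -> r ^+ 2 = u ^+ 2 + w ^+ 2 ->
  uniq s -> {in s, forall x, 0 <= x < pi} ->
  {in s &, forall x y, x != y -> rho <= `|x - y|} ->
  (count (fun x => `|u * cos x + w * sin x| < 2 * rho)%R s)%:R <= 38 / r.
Proof.
move=> rho0 /andP[r0 r2] rE us sI ssep.
rewrite -size_filter; set l := seq.filter _ s.
have sub_l : {subset l <= s} by move=> x; rewrite mem_filter => /andP[].
have ul : uniq l by rewrite filter_uniq.
have lP x : x \in l -> `|u * cos x + w * sin x| < 2 * rho.
  by rewrite mem_filter => /andP[].
clearbody l; have [->|[t tl]] : l = [::] \/ exists t, t \in l.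
    by case: (l) => [|t l']; [left|right; exists t; rewrite mem_head].
  by rewrite divr_ge0 // ltW.
pose h := 4 * rho / r.
have h0 : 0 < h by rewrite divr_gt0 // mulr_gt0.
have sin_lt x : x \in l -> `|sin (x - t)| < h.
  move=> xl; have := proj_sin_bound (lP _ xl) (lP _ tl).
  rewrite -rE -exprMn -(real_normK (num_real (r * _))).
  rewrite ltr_pXn2r ?nnegrE ?normr_ge0//; last by rewrite !mulr_ge0// ltW.
  rewrite normrM (gtr0_norm r0) /h ltr_pdivlMr// mulrC => sin_r.
  by apply: lt_le_trans sin_r _; rewrite mulrA -natrM.
have close x : x \in l ->
    (* Since [x] and [t] lie in [[0, pi)], only one side of [t + pi] and of [t - pi] can be reached,
       so these two intervals have half the length of the first. *)
    [|| t - 2 * h <= x <= t - 2 * h + 4 * h,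
        t + pi - 2 * h <= x <= t + pi - 2 * h + 2 * h
      | t - pi <= x <= t - pi + 2 * h].
  move=> xl; have := sin_lt x xl.
  have /andP[x0 x1] := sI x (sub_l x xl).
  have /andP[t0 t1] := sI t (sub_l t tl).
  have half y : 0 <= y <= pi -> `|sin y| < h -> y < 2 * h \/ pi - 2 * h < y.
    move=> /andP[y0 y1] hy; have [yp|yp] := lerP y (pi / 2).
      have /sin_ge_half : 0 <= y <= pi / 2 by rewrite y0.
      by move: hy; rewrite ltr_norml => /andP[]; left; lra.
    have /sin_ge_half : 0 <= pi - y <= pi / 2 by apply/andP; split; lra.
    rewrite sinB sinpi cospi mul0r mulN1r sub0r opprK.
    by move: hy; rewrite ltr_norml => /andP[]; right; lra.
  have [xt|xt] := lerP t x.
    have xt0 : 0 <= x - t <= pi by apply/andP; split; lra.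
    move=> /(half _ xt0)[xh|xh]; apply/or3P.
      by constructor 1; apply/andP; split; lra.
    by constructor 2; apply/andP; split; lra.
  rewrite -normrN -sinN opprB.
  have xt0 : 0 <= t - x <= pi by apply/andP; split; lra.
  move=> /(half _ xt0)[xh|xh]; apply/or3P.
    by constructor 1; apply/andP; split; lra.
  by constructor 3; apply/andP; split; lra.
have packing a L : 0 <= L ->
    (count (fun x => a <= x <= a + L) l)%:R <= L / rho + 1.
  move=> L0; rewrite -size_filter; apply: (@interval_packing _ _ a) => //.
  - by rewrite filter_uniq.
  - by move=> x; rewrite mem_filter => /andP[].
  - move=> x y; rewrite !mem_filter => /andP[_ xl] /andP[_ yl].
    exact: (ssep _ _ (sub_l _ xl) (sub_l _ yl)).
have /allP/size_le_count3 := close; rewrite -(ler_nat R) !natrD.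
move/le_trans; apply.
have p1 := packing (t - 2 * h) (4 * h) ltac:(lra).
have p2 := packing (t + pi - 2 * h) (2 * h) ltac:(lra).
have p3 := packing (t - pi) (2 * h) ltac:(lra).
have hE : h / rho = 4 / r by rewrite /h; field; rewrite !gt_eqF.
have r1 : 1 <= 2 / r by rewrite ler_pdivlMr // mul1r.
rewrite -[4 * h / rho]mulrA hE in p1; rewrite -[2 * h / rho]mulrA hE in p2 p3.
lra.
Qed.

(** * Close pairs under a fixed projection *)

(* Assign to each point of I a point of a maximal separated subset J closer
   than rho: two points in the same fibre are close, and Cauchy-Schwarz bounds
   the sum of the squared fibre sizes below by |I|^2 / m. *)
Lemma close_pairs_ge (R : realType) (T : finType) (rho m : R) (p : T -> R)
    (I : {set T}) : 0 < rho -> 0 < m ->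
  (forall J : {set T}, J \subset I ->
    {in J &, forall i j, i != j -> rho <= `|p i - p j|} -> #|J|%:R <= m) ->
  #|I|%:R ^+ 2 / m <=
    \sum_(i in I) \sum_(j in I) (`|p i - p j| < 2 * rho)%R%:R.
Proof.
move=> rho0 m0 hJ.
pose P := [pred J : {set T} | (J \subset I) &&
  [forall i in J, forall j in J, (i != j) ==> (rho <= `|p i - p j|)]].
have P0 : P finset.set0.
  by rewrite /= finset.sub0set; apply/forall_inP => i; rewrite inE.
have [J /maxsetP[/andP[JI /forall_inP Jsep] Jmax] _] := maxset_exists P0.
have {}Jsep : {in J &, forall i j, i != j -> rho <= `|p i - p j|}.
  by move=> i j iJ jJ; move/forall_inP: (Jsep i iJ) => /(_ j jJ)/implyP.
have {hJ} Jm := hJ J JI Jsep.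
have near i : i \in I -> exists j, (j \in J) && (`|p i - p j| < rho).
  move=> iI; apply/existsP; apply: contraT; rewrite negb_exists => /forallP far.
  have farJ j : j \in J -> rho <= `|p i - p j|.
    by move=> jJ; have := far j; rewrite jJ /= -leNgt.
  (* A point far from all of [J] could be added to [J], contradicting maximality. *)
  have : P (i |: J).
    rewrite /= finset.subUset finset.sub1set iI JI /=.
    apply/forall_inP => x xJ; apply/forall_inP => y yJ; apply/implyP.
    move: xJ yJ; rewrite !finset.in_setU1.
    move=> /predU1P[->|xJ] /predU1P[->|yJ].
    - by rewrite eqxx.
    - by move=> _; apply: farJ.
    - by move=> _; rewrite distrC; apply: farJ.
    - exact: Jsep.
  move=> /Jmax/(_ (finset.subsetUr _ _)) JE.
  have /farJ : i \in J by rewrite -JE finset.setU11.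
  by rewrite subrr normr0 leNgt rho0.
pose phi i := odflt i [pick j | (j \in J) && (`|p i - p j| < rho)].
have phiP i : i \in I ->
    (phi i \in J) && (`|p i - p (phi i)| < rho).
  by move=> /near[j jP]; rewrite /phi; case: pickP => //= /(_ j); rewrite jP.
pose a k : R := \sum_(i in I) (phi i == k)%:R.
have sum_phi i : i \in I -> \sum_(k in J) (phi i == k)%:R = 1 :> R.
  move=> /phiP/andP[pJ _]; rewrite (bigD1 (phi i)) //= eqxx big1 ?addr0// => k.
  by move=> /andP[_]; rewrite eq_sym => /negPf ->.
have sum_a : \sum_(k in J) a k = #|I|%:R.
  rewrite exchange_big /= (eq_bigr (fun=> 1)) => [|i iI]; last exact: sum_phi.
  by rewrite sumr_const.
(* The left side counts the pairs in a common fibre; both members are within [rho] of the same point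
   of [J], hence within [2 * rho] of each other. *)
have sum_a2 : \sum_(k in J) a k ^+ 2 <=
    \sum_(i in I) \sum_(j in I) (`|p i - p j| < 2 * rho)%R%:R.
  under eq_bigr do rewrite expr2 big_distrlr /=.
  rewrite exchange_big /=; apply: ler_sum => i iI.
  rewrite exchange_big /=; apply: ler_sum => j jI.
  have [_|far] := ltP `|p i - p j| (2 * rho).
    rewrite -[leRHS](sum_phi i iI); apply: ler_sum => k _.
    by rewrite ler_piMr ?ler0n// lern1 leq_b1.
  rewrite big1// => k _; apply/eqP; rewrite mulf_eq0 !pnatr_eq0 !eqb0 -negb_and.
  apply/negP => /andP[/eqP ik /eqP jk].
  have /andP[_ i_near] := phiP i iI; have /andP[_ j_near] := phiP j jI.
  rewrite ik in i_near; rewrite jk distrC in j_near.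
  move: far; apply/negP; rewrite -ltNge.
  by have := ler_distD (p k) (p i) (p j); lra.
apply: le_trans sum_a2.
(* Cauchy-Schwarz in the form [(a k - t) ^ 2 >= 0], with [t] the value that optimises the bound when
   [#|J|] is replaced by [m]. This avoids dividing by [#|J|]. *)
pose t : R := #|I|%:R / m.
have : \sum_(k in J) (2 * t * a k - t ^+ 2) <= \sum_(k in J) a k ^+ 2.
  by apply: ler_sum => k _; have := sqr_ge0 (a k - t); rewrite sqrrB; lra.
apply: le_trans.
rewrite sumrB -mulr_sumr sum_a sumr_const -[t ^+ 2 *+ _]mulr_natl.
have : #|J|%:R * t ^+ 2 <= m * t ^+ 2 by rewrite ler_wpM2r ?sqr_ge0.
have -> : m * t ^+ 2 = #|I|%:R ^+ 2 / m by rewrite /t; field; rewrite gt_eqF.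
have -> : 2 * t * #|I|%:R = 2 * (#|I|%:R ^+ 2 / m) by rewrite /t; ring.
lra.
Qed.

(** * Cardinalities by lists, and projections in coordinates *)

Lemma size_le_counting (R : realType) (T : choiceType) (X : set T) (s : seq T) :
  uniq s -> {in s, forall x, X x} -> ((size s)%:R%:E <= @counting T R X)%E.
Proof.
move=> us sX; rewrite /counting; case: asboolP => [Xfin|_]; last exact: leey.
rewrite lee_fin ler_nat; apply: uniq_leq_size => // x /sX Xx.
by rewrite in_fset_set// inE.
Qed.

(** An infinite set contains finite sets with more than [b] elements, so a bound on duplicate-free
    lists also rules out the value [+oo]. *)
Lemma counting_le (R : realType) (T : choiceType) (X : set T) (b : R) :
  (forall s, uniq s -> {in s, forall x, X x} -> (size s)%:R <= b) ->
  (counting X <= b%:E)%E.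
Proof.
move=> Xb; rewrite /counting; case: asboolP => [Xfin|Xinf].
  rewrite lee_fin; apply: Xb => // x.
  by rewrite in_fset_set// inE.
have b0 : 0 <= b by apply: (Xb [::]).
have [B BX] := infinite_set_fset (Num.truncn b).+1 Xinf.
rewrite -(ler_nat R) => Bb.
have := Xb (finmap.enum_fset B) (finmap.fset_uniq B) (fun x xB => BX x xB).
have /andP[_] := truncn_itv b0; move/lt_le_trans => /(_ _ Bb).
by move=> /lt_le_trans h /h; rewrite ltxx.
Qed.

(** The signed coordinate of [line_proj theta x] on its line; distances between projections become
    absolute values of differences of reals. *)
Definition dot_direction (R : realType) (theta : R) (x : 'rV[R]_2) : R :=
  x 0 0 * cos theta + x 0 1 * sin theta.

Lemma sum_ord2 (V : nmodType) (F : 'I_2 -> V) : \sum_(i < 2) F i = F 0 + F 1.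
Proof.
by rewrite !big_ord_recl big_ord0 addr0; congr (_ + F _); apply: val_inj.
Qed.

Lemma edist_line_proj (R : realType) (theta : R) (x y : 'rV[R]_2) :
  Defs.edist (line_proj theta x) (line_proj theta y) =
  `|dot_direction theta x - dot_direction theta y|.
Proof.
rewrite /Defs.edist /line_proj !sum_ord2 /dot_direction !mxE /=.
rewrite -sqrtr_sqr; congr Num.sqrt.
have := cos2Dsin2 theta; move: (cos theta) (sin theta) => p q h.
set u := x 0 0 * p + _; set v := y 0 0 * p + _.
transitivity ((u - v) ^+ 2 * (p ^+ 2 + q ^+ 2)); first by ring.
by rewrite h mulr1.
Qed.

Lemma edist_to_R1 (R : realType) (x y : R) :
  Defs.edist (to_R1 x) (to_R1 y) = `|x - y|.
Proof. by rewrite /Defs.edist big_ord1 !mxE sqrtr_sqr. Qed.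

Lemma sqr_edist2 (R : realType) (x y : 'rV[R]_2) :
  Defs.edist x y ^+ 2 = (x 0 0 - y 0 0) ^+ 2 + (x 0 1 - y 0 1) ^+ 2.
Proof. by rewrite /Defs.edist sum_ord2 sqr_sqrtr // addr_ge0 ?sqr_ge0. Qed.

(** * The two sides of the double count *)

(** The open ball of diameter [4 * t], of radius [2 * t], contains all points at distance at most
    [t]. So the ball condition bounds the distance counts as [sum_inv_le] requires, with
    [C = c * (4 / rho) ^ gamma]. *)
Lemma sum_inv_edist_le (R : realType) (gamma c rho : R) (A : set 'rV[R]_2)
    (T : finType) (a : T -> 'rV[R]_2) (i : T) :
  0 < gamma -> 0 < c -> 0 < rho -> rho_gamma_set rho gamma c A ->
  injective a -> (forall j, A (a j)) ->
  \sum_(j | j != i) (Defs.edist (a i) (a j))^-1 <=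
    4 * c `^ gamma^-1 / rho * \sum_(k < #|T|) k.+1%:R `^ (- gamma^-1).
Proof.
move=> g0 c0 rho0 [Asep Aball] ainj aA.
have sep j : j != i -> rho <= Defs.edist (a i) (a j).
  by move=> ji; apply: Asep => // /ainj /eqP; rewrite eq_sym (negPf ji).
pose e := [seq j <- index_enum T | j != i].
pose s := [seq Defs.edist (a i) (a j) | j <- e].
have s_size : (size s <= #|T|)%N.
  by rewrite size_map size_filter cardT enumT count_size.
rewrite -big_filter -/e -(big_map (fun j => Defs.edist (a i) (a j)) xpredT
  (fun v : R => v^-1)) -/s.
pose C := c * (4 / rho) `^ gamma.
have C0 : 0 <= C by rewrite mulr_ge0 ?powR_ge0 // ltW.
have s_count t : 0 < t -> (count (fun v => v <= t) s)%:R <= C * t `^ gamma.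
  move=> t0; rewrite count_map -size_filter; set l := [seq j <- _ | _].
  have [->|[j jl]] : l = [::] \/ exists j, j \in l.
      by case: (l) => [|j l']; [left|right; exists j; rewrite mem_head].
    by rewrite mulr_ge0 ?powR_ge0.
  (* The ball condition is only available from diameter [rho] on; a point [j] other than [i] within
     distance [t] forces [rho <= t]. *)
  have rho_t : rho <= 4 * t.
    move: jl; rewrite !mem_filter /= => /and3P[jt /sep ji _].
    by have := le_trans ji jt; lra.
  have := Aball (4 * t) (a i) rho_t.
  have -> : 4 * t / rho = 4 / rho * t by ring.
  rewrite powRM ?(ltW t0) ?divr_ge0 ?(ltW rho0)// mulrA -/C -lee_fin.
  apply: le_trans; rewrite -(size_map a); apply: size_le_counting.
    by rewrite map_inj_uniq// !filter_uniq// index_enum_uniq.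
  move=> _ /mapP[k + ->]; rewrite mem_filter /= => /andP[kt _].
  by split => //; rewrite /eball /=; lra.
have s0 : {in s, forall v, 0 < v}.
  move=> _ /mapP[j + ->]; rewrite mem_filter => /andP[/sep + _].
  exact: lt_le_trans.
apply: (le_trans (sum_inv_le C0 g0 s0 s_count)).
have -> : C `^ gamma^-1 = 4 * c `^ gamma^-1 / rho.
  have r0 : 0 <= 4 / rho by rewrite divr_ge0 ?(ltW rho0).
  rewrite powRM ?powR_ge0 ?(ltW c0)// -powRrM mulfV ?gt_eqF// powRr1//; ring.
apply: ler_wpM2l; first by rewrite divr_ge0 ?(ltW rho0)// mulr_ge0 ?powR_ge0.
rewrite -!(big_mkord xpredT (fun k => k.+1%:R `^ _)).
rewrite [leRHS](big_cat_nat (n := size s))//= lerDl.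
by apply: sumr_ge0 => k _; apply: powR_ge0.
Qed.

Lemma offdiag_pairs_ge (R : realType) (T : finType) (rho delta m : R)
    (p : T -> R) (I : {set T}) :
  0 < rho -> 0 < m -> m <= delta ^+ 2 * #|T|%:R / 4 ->
  0 <= delta -> delta * #|T|%:R <= #|I|%:R ->
  (forall J : {set T}, J \subset I ->
    {in J &, forall i j, i != j -> rho <= `|p i - p j|} -> #|J|%:R <= m) ->
  3 / 4 * (delta ^+ 2 * #|T|%:R ^+ 2 / m) <=
    \sum_i \sum_(j | j != i) (`|p i - p j| < 2 * rho)%R%:R.
Proof.
move=> rho0 m0 hm d0 hI hJ.
have := close_pairs_ge rho0 m0 hJ.
have h1 : \sum_(i in I) \sum_(j in I) (`|p i - p j| < 2 * rho)%R%:R <=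
    #|T|%:R + \sum_i \sum_(j | j != i) (`|p i - p j| < 2 * rho)%R%:R :> R.
  have -> : #|T|%:R = \sum_(i : T) 1 :> R by rewrite sumr_const.
  rewrite -big_split /=.
  have sub (P Q : pred T) (F : T -> R) : (forall i, 0 <= F i) ->
      (forall i, P i -> Q i) -> \sum_(i | P i) F i <= \sum_(i | Q i) F i.
    move=> F0 PQ; rewrite big_mkcond [leRHS]big_mkcond /=.
    by apply: ler_sum => i _; case: ifP => [/PQ ->|_] //; case: ifP.
  apply: (@le_trans _ _ (\sum_(i in I)
      (1 + \sum_(j | j != i) (`|p i - p j| < 2 * rho)%R%:R))).
    apply: ler_sum => i iI; rewrite (bigD1 i)//= subrr normr0 mulr_gt0// lerD2l.
    by apply: sub => [j|j /andP[]//]; rewrite ler0n.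
  apply: sub => // i; rewrite addr_ge0// sumr_ge0// => j _; exact: ler0n.
have N0 : 0 <= #|T|%:R :> R by rewrite ler0n.
have h2 : delta ^+ 2 * #|T|%:R ^+ 2 / m <= #|I|%:R ^+ 2 / m.
  rewrite ler_pM2r ?invr_gt0// -exprMn.
  by rewrite ler_pXn2r// nnegrE ?ler0n// mulr_ge0.
(* The diagonal contributes at most [#|T|], and [m <= delta^2 * #|T| / 4], multiplied by [#|T| / m],
   makes this a quarter of the main term. *)
have h3 : #|T|%:R <= delta ^+ 2 * #|T|%:R ^+ 2 / m / 4.
  rewrite mulrAC ler_pdivlMr//.
  have : #|T|%:R * m <= #|T|%:R * (delta ^+ 2 * #|T|%:R / 4).
    by rewrite ler_wpM2l.
  by rewrite expr2; lra.
lra.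
Qed.

(** Both sides bound the number of triples of a direction in [s] and two distinct indices whose
    projections are closer than [2 * rho]: from below by summing over directions first, from above
    by summing over pairs first. *)
Lemma exceptional_directions_le (R : realType) (gamma c rho delta m : R)
    (A : set 'rV[R]_2) (T : finType) (a : T -> 'rV[R]_2) (s : seq R) :
  0 < gamma -> 0 < c -> 0 < rho -> rho_gamma_set rho gamma c A ->
  A `<=` [set x : 'rV[R]_2 | forall i, 0 <= x 0 i <= 1] ->
  injective a -> (forall j, A (a j)) ->
  uniq s -> {in s, forall x, 0 <= x < pi} ->
  {in s &, forall x y, x != y -> rho <= `|x - y|} ->
  0 <= delta -> 0 < m -> m <= delta ^+ 2 * #|T|%:R / 4 ->
  {in s, forall theta, exists2 I : {set T}, delta * #|T|%:R <= #|I|%:R &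
    forall J : {set T}, J \subset I ->
    {in J &, forall i j, i != j ->
      rho <= `|dot_direction theta (a i) - dot_direction theta (a j)|} ->
    #|J|%:R <= m} ->
  (size s)%:R * (3 / 4 * (delta ^+ 2 * #|T|%:R ^+ 2 / m)) <=
  #|T|%:R * (38 * (4 * c `^ gamma^-1 / rho *
    \sum_(k < #|T|) k.+1%:R `^ (- gamma^-1))).
Proof.
move=> g0 c0 rho0 Aball A01 ainj aA us sI ssep d0 m0 hm hs.
pose close theta i j :=
  `|dot_direction theta (a i) - dot_direction theta (a j)| < 2 * rho.
apply: (@le_trans _ _ (\sum_(theta <- s) \sum_i \sum_(j | j != i)
    (close theta i j)%:R)).
  rewrite -sum1_size natr_sum mulr_suml big_seq [leRHS]big_seq.
  apply: ler_sum => theta /hs[I hI hJ]; rewrite mul1r.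
  exact: offdiag_pairs_ge hJ.
rewrite exchange_big /= mulr_natl -sumr_const; apply: ler_sum => i _.
rewrite exchange_big /=.
apply: le_trans (_ : 38 * \sum_(j | j != i) (Defs.edist (a i) (a j))^-1 <= _);
  last by rewrite ler_wpM2l//; apply: sum_inv_edist_le Aball ainj aA.
rewrite mulr_sumr; apply: ler_sum => j ji.
have r_rho : rho <= Defs.edist (a i) (a j).
  by apply: Aball.1 => // /ainj /eqP; rewrite eq_sym (negPf ji).
(* Points of the unit square have squared distance at most 2, which is below 4. *)
have r2 : Defs.edist (a i) (a j) <= 2.
  rewrite -(@ler_pXn2r _ 2)// ?nnegrE ?sqrtr_ge0// sqr_edist2.
  have := A01 _ (aA i); have := A01 _ (aA j) => /= hi hj.
  have := hi 0; have := hi 1; have := hj 0; have := hj 1.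
  have sq (x y : R) : 0 <= x <= 1 -> 0 <= y <= 1 -> (x - y) ^+ 2 <= 1.
    move=> /andP[x0 x1] /andP[y0 y1].
    have /mulr_ge0 : 0 <= 1 - (x - y) by lra.
    by move=> /(_ (1 + (x - y)) ltac:(lra)); lra.
  by move=> a1 a2 a3 a4; have := sq _ _ a1 a3; have := sq _ _ a2 a4; lra.
have := @count_directions R rho (a i 0 0 - a j 0 0) (a i 0 1 - a j 0 1)
  (Defs.edist (a i) (a j)) s rho0.
rewrite r2 (lt_le_trans rho0 r_rho) => /(_ isT (sqr_edist2 _ _) us sI ssep).
apply: le_trans.
rewrite -sum1_count natr_sum [leRHS]big_mkcond /=; apply: ler_sum => theta _.
have -> : (a i 0 0 - a j 0 0) * cos theta + (a i 0 1 - a j 0 1) * sin theta =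
  dot_direction theta (a i) - dot_direction theta (a j).
  by rewrite /dot_direction; ring.
by rewrite /close; case: ifP.
Qed.

(** * From sets and entropies to finite families *)

Theorem theorem3p2 (R : realType) (gamma c : R)
  (hgamma : 0 < gamma) (hc : 0 < c) :
  exists2 K : R, 0 < K &
  forall (rho : R) (A : set 'rV[R]_2) (n : nat),
    0 < rho ->
    A `<=` [set x : 'rV[R]_2 | forall i, 0 <= x 0 i <= 1] ->
    rho_gamma_set rho gamma c A ->
    (A #= `I_n)%card ->
    (0 < n)%N ->
    - ln c < n%:R ->
  forall delta m : R,
    0 < delta ->
    0 <= m <= delta ^+ 2 * n%:R / 4 ->
  let E : set R := [set theta : R | 0 <= theta < pi /\
    exists A' : set 'rV[R]_2,
      [/\ A' `<=` A,
          ((delta * n%:R)%:E <= counting A')%E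
        & (metric_entropy (line_proj theta @` A') rho <= m%:E)%E]] in
  (metric_entropy (@to_R1 R @` E) rho <=
    (K * rho^-1 * (m / (delta ^+ 2 * n%:R)) *
     (if gamma != 1 then n%:R `^ (1 - Num.min gamma 1 / gamma)
      else ln n%:R))%:E)%E : Prop.
Proof.
have [D D0 HD] := sum_powR_growth hgamma.
have cg0 : 0 < c `^ gamma^-1 by rewrite powR_gt0.
(* Here [4 / 3] inverts the [3 / 4] left after removing the diagonal, 38 comes from
   [count_directions], [4 * c ^ (1 / gamma)] from [sum_inv_edist_le] and [D] from
   [sum_powR_growth]. *)
exists (4 / 3 * 38 * 4 * c `^ gamma^-1 * D).
  by rewrite !mulr_gt0// divr_gt0.
move=> rho A n rho0 A01 AB An n0 _ delta m d0 /andP[m0 hm] E.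
set S := if _ then _ else _.
have N0 : 0 < n%:R :> R by rewrite ltr0n.
have S0 : 0 <= S.
  by rewrite /S; case: ifP => _; rewrite ?powR_ge0// ln_ge0// ler1n.
have Afin : finite_set A by apply/finite_setP; exists n.
pose sA := finmap.enum_fset (fset_set A).
have sA_size : size sA = n by exact: card_fset_set.
pose a (i : 'I_n) := nth 0 sA i.
have a_mem i : a i \in sA by rewrite mem_nth ?sA_size.
have aA i : A (a i).
  by have := a_mem i; rewrite in_fset_set// inE.
have ainj : injective a.
  move=> i j /eqP; rewrite nth_uniq ?sA_size ?finmap.fset_uniq// => /eqP.
  exact: val_inj.
have asurj x : A x -> exists i, x = a i.
  move=> Ax; have xs : x \in sA by rewrite in_fset_set// inE.
  have ix : (index x sA < n)%N by rewrite -sA_size index_mem.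
  by exists (Ordinal ix); rewrite /a nth_index.
apply: ge_ereal_sup => _ [X [XE Xsep] <-].
apply: counting_le => l ul lX.
have to_R1K t : @to_R1 R t 0 0 = t by rewrite mxE.
pose s := [seq (v : 'rV[R]_1) 0 0 | v <- l].
have ls v : v \in l -> v = to_R1 (v 0 0).
  by move=> _; apply/rowP => i; rewrite mxE (ord1 i).
have us : uniq s.
  rewrite map_inj_in_uniq// => v w vl wl vw.
  by rewrite (ls v)// (ls w)// vw.
have sE : {in s, forall x, E x}.
  by move=> _ /mapP[v vl ->]; have [t Et <-] := XE _ (lX v vl); rewrite to_R1K.
have ssep : {in s &, forall x y, x != y -> rho <= `|x - y|}.
  move=> _ _ /mapP[v vl ->] /mapP[w wl ->] vw.
  rewrite -edist_to_R1 -!ls//; apply: Xsep; [exact: lX..|].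
  by move=> vwE; rewrite vwE eqxx in vw.
have {us sE ssep} : (size s)%:R <=
    4 / 3 * 38 * 4 * c `^ gamma^-1 * D / rho * (m / (delta ^+ 2 * n%:R)) * S.
  (* Take for [I] the indices of the points of [A']. A [J] with separated projections yields a
     separated subset of the projection of [A'], so the entropy bounds its size. *)
  have sI : {in s, forall theta, exists2 I : {set 'I_n},
      delta * n%:R <= #|I|%:R & forall J : {set 'I_n}, J \subset I ->
    {in J &, forall i j, i != j ->
      rho <= `|dot_direction theta (a i) - dot_direction theta (a j)|} ->
    #|J|%:R <= m}.
    move=> theta /sE[_ [A' [A'A A'ge A'm]]].
    exists [set i | `[< A' (a i) >]]%SET.
      rewrite -lee_fin; apply: le_trans A'ge _; apply: counting_le => t ut tA'.
      rewrite ler_nat cardE -(size_map a); apply: uniq_leq_size => // x xt.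
      have [i xi] := asurj x (A'A x (tA' x xt)).
      rewrite xi; apply: map_f; rewrite mem_enum inE -xi; apply/asboolP.
      exact: tA'.
    move=> J JI Jsep; rewrite -lee_fin; apply: le_trans A'm.
    pose P i := line_proj theta (a i).
    (* Projecting [J] loses no points: distinct indices have projections at distance at least
       [rho > 0]. *)
    have Pinj : {in J &, injective P}.
      move=> i j iJ jJ Pij; apply/eqP; apply: contraT => /(Jsep i j iJ jJ).
      rewrite -edist_line_proj -/(P i) -/(P j) Pij /Defs.edist.
      rewrite big1 => [|k _]; last by rewrite subrr expr0n.
      by rewrite sqrtr0 leNgt rho0.
    have PA' i : i \in J -> A' (a i).
      by move=> /(fintype.subsetP JI); rewrite inE => /asboolP.
    apply: (@le_trans _ _ (counting (P @` [set i | i \in J]))).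
      rewrite cardE -(size_map P); apply: size_le_counting.
        rewrite map_inj_in_uniq ?enum_uniq// => i j; rewrite !mem_enum.
        exact: Pinj.
      move=> _ /mapP[i + ->]; rewrite mem_enum => iJ.
      by exists i.
    apply: ereal_sup_ubound; exists (P @` [set i | i \in J]) => //; split.
      by move=> _ [i /= iJ <-]; exists (a i) => //; apply: PA'.
    move=> _ _ [i /= iJ <-] [j /= jJ <-] Pij.
    rewrite edist_line_proj; apply: Jsep => //.
    by apply: contra_not_neq Pij => ->.
  (* Without exceptional directions only nonnegativity of the bound is claimed. *)
  have [->|[t ts]] : s = [::] \/ exists t, t \in s.
      by case: (s) => [|t s']; [left|right; exists t; rewrite mem_head].
    have dn0 : 0 <= delta ^+ 2 * n%:R by rewrite mulr_ge0 ?sqr_ge0 // ltW.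
    by rewrite !mulr_ge0 ?invr_ge0 ?(ltW rho0) ?(ltW D0) ?(ltW cg0) ?dn0.
  (* One exceptional direction forces m >= 1 and delta <= 1, hence n >= 4;
     this is what makes [ln n] usable as a bound when gamma = 1. *)
  have [m1 n1] : 1 <= m /\ (1 < n)%N.
    have [I hI hJ] := sI t ts.
    have : 0 < #|I|%:R :> R by apply: lt_le_trans hI; rewrite mulr_gt0.
    rewrite ltr0n card_gt0 => /set0Pn[i iI].
    have m1 : 1 <= m.
      (* A singleton is vacuously separated, so its size 1 is at most [m]. *)
      have := hJ [set i]%SET; rewrite cards1; apply.
        by rewrite finset.sub1set.
      by move=> x y; rewrite !inE => /eqP-> /eqP->; rewrite eqxx.
    split=> //; rewrite -(ltr_nat R).
    have d1 : delta <= 1.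
      have : delta * n%:R <= 1 * n%:R.
        apply: le_trans hI _; rewrite mul1r ler_nat -[leqRHS]card_ord.
        exact: max_card.
      by rewrite ler_pM2r.
    have : delta ^+ 2 * n%:R <= 1 * n%:R.
      by rewrite ler_pM2r// expr_le1 // ltW.
    lra.
  have m_gt0 : 0 < m by lra.
  have := @exceptional_directions_le R gamma c rho delta m A 'I_n a s hgamma hc
    rho0 AB A01 ainj aA us (fun x xs => (sE x xs).1) ssep (ltW d0) m_gt0.
  rewrite card_ord => /(_ hm sI).
  have := HD n n1; rewrite -/S; set H := \sum_(k < n) _ => HS hs.
  have : 3 / 4 * (delta ^+ 2 * n%:R ^+ 2 / m) * (size s)%:R <=
    n%:R * (38 * (4 * c `^ gamma^-1 / rho * (D * S))).
    rewrite mulrC; apply: le_trans hs _.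
    rewrite ler_pM2l// ler_pM2l// ler_pM2l// divr_gt0// mulr_gt0//.
  have q0 : 0 < 3 / 4 * (delta ^+ 2 * n%:R ^+ 2 / m).
    by rewrite mulr_gt0 ?divr_gt0 ?mulr_gt0 ?exprn_gt0.
  rewrite -ler_pdivlMl//; move/le_trans; apply.
  rewrite le_eqVlt; apply/orP; left; apply/eqP; field.
  by rewrite !gt_eqF.
by rewrite size_map.
Qed.
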